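(* For $n\geqslant 1$ and $m,d\geqslant 0$, let $\mathfrak{B}_{n,m,d}$ be the set of inversion sequences of length $n$ avoiding the pattern $010$ whose maximum value is $m$ and which contain exactly $d$ distinct values, and let $\mathfrak{b}_{n,m,d}=\#\mathfrak{B}_{n,m,d}$ (so $\#\mathbf{I}_n(010)=\sum_{m=0}^{n-1}\sum_{d=0}^{n}\mathfrak{b}_{n,m,d}$, and $\mathfrak{b}_{n,0,d}=1$ if $d=1$ and $0$ otherwise). Then for all $n\geqslant 1$, $m\geqslant 1$ and $d\geqslant 0$, $$\mathfrak{b}_{n,m,d}=\sum_{i=0}^{d-1}\binom{m-i}{d-i-1}\sum_{p=m+1}^{n}\genfrac{[}{]}{0pt}{}{n-p+1}{n-p-d+i+2}\sum_{j=0}^{m-1}\mathfrak{b}_{p-1,j,i}.$$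
   Context: An inversion sequence of length $n$ is a sequence $\sigma=(\sigma_1,\dots,\sigma_n)$ of nonnegative integers with $0\leqslant\sigma_i<i$ for all $i$; $\mathbf{I}_n(P)$ is the set of those avoiding every pattern in $P$. A sequence $\sigma$ contains a pattern $p=(p_1,\dots,p_k)$ if some subsequence $(\sigma_{i_1},\dots,\sigma_{i_k})$, $i_1<\dots<i_k$, is order-isomorphic to $p$; otherwise it avoids $p$. Avoiding $010$ means there are no $i<j<l$ with $\sigma_i=\sigma_l<\sigma_j$. $\genfrac{[}{]}{0pt}{}{a}{b}$ is the unsigned Stirling number of the first kind (permutations of $a$ elements with $b$ cycles), taken to be $0$ if $b\leqslant 0$ (for $a\geqslant1$) or $b>a$. Binomial coefficients $\binom{a}{b}$ are $0$ when $b<0$ or $b>a$. *)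

(* Defs.v *)
From mathcomp Require Import all_boot all_order all_algebra all_fingroup.
Set Implicit Arguments. Unset Strict Implicit. Unset Printing Implicit Defensive.
Import GRing.Theory Num.Theory.

(* Sequences of length n with values in 'I_n (any inversion sequence of length n
   has values < n, so this is no restriction). Index i : 'I_n corresponds to the
   paper's position i+1, so the condition 0 <= sigma_{i+1} < i+1 reads s_i <= i. *)
Definition is_invseq (n : nat) (s : n.-tuple 'I_n) : bool :=
  [forall i : 'I_n, (tnth s i <= i)%N].

Definition avoids010 (n : nat) (s : n.-tuple 'I_n) : bool :=
  ~~ [exists i : 'I_n, exists j : 'I_n, exists l : 'I_n,
        [&& (i < j)%N, (j < l)%N, tnth s i == tnth s l & (tnth s i < tnth s j)%N]].

Definition maxval (n : nat) (s : n.-tuple 'I_n) : nat := \max_(i < n) (nat_of_ord (tnth s i)).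

Definition ndistinct (n : nat) (s : n.-tuple 'I_n) : nat := #|[set tnth s i | i : 'I_n]|.

Definition bnum (n m d : nat) : nat :=
  #|[set s : n.-tuple 'I_n | [&& is_invseq s, avoids010 s, maxval s == m & ndistinct s == d]]|.

Definition stirling1 (a b : nat) : nat :=
  #|[set s : {perm 'I_a} | #|porbits s| == b]|.

Definition stirz (a : nat) (b : int) : nat :=
  match b with Posz k => stirling1 a k | Negz _ => 0%N end.

Definition binz (a b : int) : nat :=
  match a, b with
  | Posz a', Posz b' => 'C(a', b')
  | _, _ => 0%N
  end.

(* Main.v *)
Require Import Defs.
From mathcomp Require Import all_boot all_order all_algebra all_fingroup.
From mathcomp Require Import zify.
Import GRing.Theory Num.Theory.

Set Implicit Arguments.
Unset Strict Implicit.

(** Cut a sequence at the first occurrence of its maximum [m]: [s = u ++ m :: t].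
    Then [s] avoids 010 iff [u] and [t] do and they share no value, so [t] is a
    010-avoiding word over [m] and the values below [m] missing from [u]; being
    after a position at least [m], it is not constrained by the inversion
    condition. In a 010-avoiding word the occurrences of the smallest letter are
    contiguous, so deleting its first occurrence shows that the number of such
    words satisfies the recurrence of the Stirling numbers of the first kind. *)

(** * Cardinality of predicates through duplicate-free lists *)

(** Serves to count inside infinite types such as [seq nat], with no ambient finite type fixed
    beforehand. *)
Definition card_is (T : eqType) (P : T -> Prop) (N : nat) : Prop :=
  exists r : seq T, [/\ uniq r, forall x, x \in r <-> P x & size r = N].

Lemma card_is_inj (T : eqType) (P : T -> Prop) N N' :
  card_is P N -> card_is P N' -> N = N'.
Proof.
move=> [r [ur rP <-]] [r' [ur' rP' <-]].
apply/perm_size/uniq_perm => // x; apply/idP/idP.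
  by move=> /rP/rP'.
by move=> /rP'/rP.
Qed.

Lemma eq_card_is (T : eqType) (P Q : T -> Prop) N :
  (forall x, P x <-> Q x) -> card_is P N -> card_is Q N.
Proof.
move=> PQ [r [ur rP sr]]; exists r; split=> // x.
by rewrite rP.
Qed.

Lemma card_is0 (T : eqType) (P : T -> Prop) : (forall x, ~ P x) -> card_is P 0.
Proof. by move=> P0; exists [::]; split=> // x; split=> // /P0. Qed.

Lemma card_is1 (T : eqType) (x : T) : card_is (fun y => y = x) 1.
Proof. by exists [:: x]; split=> // y; rewrite inE; split=> [/eqP|->]. Qed.

Lemma card_isU (T : eqType) (P Q : T -> Prop) M N :
  (forall x, P x -> ~ Q x) -> card_is P M -> card_is Q N ->
  card_is (fun x => P x \/ Q x) (M + N).
Proof.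
move=> PQ [r [ur rP <-]] [r' [ur' rP' <-]]; exists (r ++ r').
split; last by rewrite size_cat.
  rewrite cat_uniq ur ur' andbT /=; apply/hasPn => x /rP' Qx.
  by apply/negP => /rP Px; apply: (PQ x).
move=> x; rewrite mem_cat; split.
  by case/orP=> [/rP|/rP']; [left|right].
by case=> [/rP|/rP'] ->; rewrite ?orbT.
Qed.

Lemma card_is_bigU (I T : eqType) (r : seq I) (P : I -> T -> Prop) (F : I -> nat) :
  uniq r -> (forall i, i \in r -> card_is (P i) (F i)) ->
  (forall i j x, i \in r -> j \in r -> P i x -> P j x -> i = j) ->
  card_is (fun x => exists2 i, i \in r & P i x) (\sum_(i <- r) F i).
Proof.
elim: r => [_ _ _|i r IHr /=/andP[ir ur] cP dP].
  by rewrite big_nil; apply: card_is0 => x [].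
rewrite big_cons.
have cPi : card_is (P i) (F i) by apply: cP; rewrite mem_head.
have cPr : card_is (fun x => exists2 i, i \in r & P i x) (\sum_(i <- r) F i).
  apply: IHr => // [j jr|j k x jr kr]; first by apply: cP; rewrite inE jr orbT.
  by apply: dP; rewrite inE ?jr ?kr orbT.
apply: eq_card_is (card_isU _ cPi cPr) => [x|x Px [j jr Pj]].
  split=> [[Px|[j jr Pj]]|[j]]; first by exists i; rewrite ?mem_head.
    by exists j; rewrite ?inE ?jr ?orbT.
  by rewrite inE => /orP[/eqP->|jr] Pj; [left|right; exists j].
move: ir; rewrite (dP i j x) ?jr // inE ?eqxx ?jr ?orbT //.
Qed.

Lemma card_is_image (S T : eqType) (f : S -> T) (P : S -> Prop) N :
  (forall x y, P x -> P y -> f x = f y -> x = y) -> card_is P N ->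
  card_is (fun y => exists2 x, P x & y = f x) N.
Proof.
move=> fI [r [ur rP <-]]; exists (map f r); split; last by rewrite size_map.
  by rewrite map_inj_in_uniq // => x y /rP Px /rP Py; apply: fI.
move=> y; split; first by case/mapP=> x /rP Px ->; exists x.
by case=> x /rP xr ->; apply: map_f.
Qed.

(** The fibres over different [x] are disjoint and all have the same size [N], so the disjoint union
    has a constant summand. *)
Lemma card_is_prod (S T : eqType) (P : S -> Prop) (Q : S -> T -> Prop) M N :
  card_is P M -> (forall x, P x -> card_is (Q x) N) ->
  (forall x x' y, P x -> P x' -> Q x y -> Q x' y -> x = x') ->
  card_is (fun y => exists2 x, P x & Q x y) (M * N).
Proof.
move=> [r [ur rP <-]] cQ dQ.
have -> : size r * N = \sum_(i <- r) N.
  by rewrite big_const_seq count_predT iter_addn_0 mulnC.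
have H := @card_is_bigU S T r Q (fun=> N) ur.
apply: eq_card_is (H _ _).
- by move=> y; split=> -[x /rP Px Qy]; exists x.
- by move=> x /rP; apply: cQ.
- by move=> x x' y /rP Px /rP Px'; apply: dQ.
Qed.

(** * Stirling numbers of the first kind and their recurrence *)

Lemma porbit_lift_perm0 n (s : {perm 'I_n}) x :
  porbit (lift_perm ord0 ord0 s) (lift ord0 x) = lift ord0 @: porbit s x.
Proof.
have itE i : (lift_perm ord0 ord0 s ^+ i)%g (lift ord0 x) = lift ord0 ((s ^+ i)%g x).
  by elim: i => [|i IHi]; rewrite ?expg0 ?perm1 // !expgSr !permM IHi lift_perm_lift.
apply/setP => y; apply/porbitP/imsetP => [[i ->]|[z /porbitP[i ->] ->]].
  by rewrite itE; exists ((s ^+ i)%g x); rewrite ?mem_porbit.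
by exists i; rewrite itE.
Qed.

Lemma porbit_lift_perm00 n (s : {perm 'I_n}) :
  porbit (lift_perm ord0 ord0 s) ord0 = [set ord0].
Proof.
apply/setP => y; rewrite inE; apply/porbitP/eqP => [[i ->]|->]; last first.
  by exists 0; rewrite expg0 perm1.
by elim: i => [|i IHi]; rewrite ?expg0 ?perm1 // expgSr permM IHi lift_perm_id.
Qed.

(** The fixed point [ord0] is a cycle of its own; the other cycles are the shifted cycles of [s]. *)
Lemma card_porbits_lift_perm0 n (s : {perm 'I_n}) :
  #|porbits (lift_perm ord0 ord0 s)| = #|porbits s|.+1.
Proof.
have -> : porbits (lift_perm ord0 ord0 s) =
    [set ord0] |: [set lift ord0 @: A | A : {set 'I_n} in porbits s].
  apply/setP => A; rewrite !inE; apply/imsetP/orP => [[x _ ->]|].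
    case: (unliftP ord0 x) => [y|] ->; last by left; rewrite porbit_lift_perm00.
    by right; rewrite porbit_lift_perm0; apply/imset_f/imset_f.
  case=> [/eqP->|/imsetP[B /imsetP[x _ ->] ->]].
    by exists ord0; rewrite ?porbit_lift_perm00.
  by exists (lift ord0 x); rewrite ?porbit_lift_perm0.
rewrite cardsU1 card_imset; last exact/imset_inj/lift_inj.
rewrite (_ : _ \notin _) //; apply/imsetP => -[B _] /setP/(_ ord0).
by rewrite inE eqxx => /esym/imsetP[x _] /eqP; rewrite (negPf (neq_lift _ _)).
Qed.

(** For [x] different from [ord0] the transposition merges the fixed point [ord0] into the cycle of
    [x]; for [x = ord0] it is the identity and the extra cycle stays. *)
Lemma card_porbits_tperm_lift n (s : {perm 'I_n}) (x : 'I_n.+1) :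
  #|porbits (tperm ord0 x * lift_perm ord0 ord0 s)%g| = (x == ord0) + #|porbits s|.
Proof.
have := porbits_mul_tperm (lift_perm ord0 ord0 s) x ord0.
rewrite /= porbit_lift_perm00 card_porbits_lift_perm0 inE tpermC.
by case: (x == ord0) => /=; lia.
Qed.

(** Injectivity suffices, since both sides have [n.+1] factorial elements. *)
Lemma bij_tperm_lift_perm n :
  bijective (fun p : 'I_n.+1 * {perm 'I_n} =>
    (tperm ord0 p.1 * lift_perm ord0 ord0 p.2)%g).
Proof.
apply: inj_card_bij; last by rewrite card_prod card_ord !card_Sn factS.
move=> [x s] [y t] /= fE.
(* [x] is recovered as the preimage of [ord0] under the product. *)
have xy : x = y.
  apply: (@perm_inj _ (tperm ord0 x * lift_perm ord0 ord0 s)%g).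
  by rewrite [in RHS]fE !permM !tpermR !lift_perm_id.
rewrite xy in fE *; congr pair; apply/permP => k.
by move/mulgI/permP/(_ (lift ord0 k)): fE; rewrite !lift_perm_lift => /lift_inj.
Qed.

(** Under the bijection above, the [a] choices of [x] other than [ord0] keep the number of cycles,
    and [x = ord0] adds one. *)
Lemma stirling1S a b :
  stirling1 a.+1 b =
  a * stirling1 a b + (if b is b'.+1 then stirling1 a b' else 0).
Proof.
have [g fK gK] := bij_tperm_lift_perm a.
pose A c := [set s : {perm 'I_a} | #|porbits s| == c].
have Ag : [set s : {perm 'I_a.+1} | #|porbits s| == b] =
    g @^-1: (setX [set~ ord0] (A b) :|: (if b is b'.+1 then setX [set ord0] (A b') else set0)).
  apply/setP => s; rewrite -(gK s) !inE fK card_porbits_tperm_lift.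
  case: (g s) => x t /=.
  by case: b => [|b] /=; rewrite !inE; case: (x == ord0) => //=; rewrite ?orbF.
rewrite /stirling1 Ag on_card_preimset; last first.
  by apply: onW_bij; exists (fun p => (tperm ord0 p.1 * lift_perm ord0 ord0 p.2)%g).
rewrite cardsU cardsX cardsC1 card_ord.
rewrite (_ : _ :&: _ = set0) ?cards0 ?subn0; last first.
  by apply/setP => -[x s]; case: (b) => [|c]; rewrite !inE; case: (x == ord0); rewrite ?andbF.
by case: (b) => [|c]; rewrite ?cards0 // cardsX cards1 mul1n.
Qed.

Lemma stirling10 b : stirling1 0 b = (b == 0).
Proof.
have p0 (s : {perm 'I_0}) : #|porbits s| = 0.
  by apply/eqP; rewrite -leqn0 -[leqRHS](card_ord 0) leq_imset_card.
rewrite /stirling1 eq_sym; case: eqP => [<-|b0] /=.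
  rewrite (_ : [set _ | _] = setT) ?cardsT ?card_Sn //.
  by apply/setP => s; rewrite !inE p0.
apply/eqP; rewrite cards_eq0; apply/eqP/setP => s; rewrite !inE p0.
by apply/eqP.
Qed.

Lemma stirling1_gt a b : a < b -> stirling1 a b = 0.
Proof.
elim: a b => [|a IHa] [|b] //; first by rewrite stirling10.
by move=> ab; rewrite stirling1S !IHa ?muln0 //; lia.
Qed.

Lemma stirling1nn a : stirling1 a a = 1.
Proof.
elim: a => [|a IHa]; first by rewrite stirling10.
by rewrite stirling1S IHa stirling1_gt ?muln0.
Qed.

Lemma stirling1S0 a : stirling1 a.+1 0 = 0.
Proof.
by elim: a => [|a IHa]; rewrite stirling1S addn0 ?mul0n // IHa muln0.
Qed.

(* The number of 010-avoiding words of length [L] over a maximal letter and [k]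
   smaller letters in which all the smaller letters occur, see [card_words]. *)
Definition wordnum L k := stirling1 L.+1 (L.+1 - k).

Lemma wordnum0 L : wordnum L 0 = 1.
Proof. exact: stirling1nn. Qed.

Lemma wordnum0S k : wordnum 0 k.+1 = 0.
Proof. exact: stirling1S0. Qed.

Lemma wordnumSS L k : wordnum L.+1 k.+1 = L.+1 * wordnum L k + wordnum L k.+1.
Proof.
rewrite /wordnum subSS stirling1S; congr addn.
(* If [k] exceeds [L], the truncated difference is already [0]; the recurrence then has no second
   term, in agreement with [stirling1 L.+1 0 = 0]. *)
by have := subnS L.+1 k; case: (L.+1 - k) => [|c] /= ->; rewrite ?stirling1S0.
Qed.

(** * Inserting and deleting the smallest letter of a 010-avoiding word *)

Definition avoids (s : seq nat) := forall x y, x < y -> ~~ subseq [:: x; y; x] s.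

Lemma avoids_subseq s t : subseq s t -> avoids t -> avoids s.
Proof. by move=> st At x y /At; apply: contraNN => /subseq_trans->. Qed.

Lemma subseq_cat_notin (T : eqType) (x : T) r s t :
  x \notin s -> subseq (x :: r) (s ++ t) = subseq (x :: r) t.
Proof.
by elim: s => //= y s IHs; rewrite inE; case: eqVneq.
Qed.

Definition ins (i a : nat) (t : seq nat) := take i t ++ a :: drop i t.

Lemma size_ins i a t : size (ins i a t) = (size t).+1.
Proof. by rewrite size_cat /= addnS -size_cat cat_take_drop. Qed.

Lemma mem_ins i a t x : (x \in ins i a t) = (x == a) || (x \in t).
Proof. by rewrite -[in RHS](cat_take_drop i t) !(mem_cat, inE) orbCA. Qed.

Lemma index_ins i (a : nat) t : a \notin take i t -> i <= size t -> index a (ins i a t) = i.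
Proof.
by move=> /negPf at1 it; rewrite index_cat at1 /= eqxx addn0 size_take_min (minn_idPl it).
Qed.

Lemma rem_ins i (a : nat) t : a \notin take i t -> rem a (ins i a t) = t.
Proof.
move=> at1; rewrite -[RHS](cat_take_drop i t) /ins.
elim: (take i t) at1 => [|b r IHr] /=; first by rewrite eqxx.
by rewrite inE; case: eqVneq => //= _ /IHr->.
Qed.

Lemma ins_index_rem (a : nat) t : a \in t -> ins (index a t) a (rem a t) = t.
Proof.
rewrite /ins; elim: t => //= b t IHt; rewrite inE eq_sym.
by case: eqP => [->|_] /= at_; rewrite ?take0 ?drop0 ?IHt.
Qed.

Lemma notin_take_index_rem (a : nat) t : a \notin take (index a t) (rem a t).
Proof.
elim: t => //= b t IHt; case: eqP => [_|/eqP ba] /=; rewrite ?take0 //.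
by rewrite inE negb_or eq_sym ba.
Qed.

Lemma filter_ins i a t : filter (predC1 a) (ins i a t) = filter (predC1 a) t.
Proof. by rewrite -[in RHS](cat_take_drop i t) !filter_cat /= eqxx. Qed.

(* A pattern whose low letter is not the minimum [a] does not use [a] at all. *)
Lemma avoids_ins i a t : (forall x, x \in t -> a <= x) -> avoids t ->
  (forall y, a < y -> ~~ subseq [:: a; y; a] (ins i a t)) -> avoids (ins i a t).
Proof.
move=> mina At Aa x y xy; have [xa|xa] := eqVneq x a.
  by rewrite xa in xy *; apply: Aa.
apply/negP => sub; have /negP := At x y xy; apply.
have ax : a <= x.
  have := mem_subseq sub (mem_head _ _).
  by rewrite mem_ins (negPf xa) => /mina.
have : subseq [:: x; y; x] (filter (predC1 a) (ins i a t)).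
  by rewrite subseq_filter sub /= xa (gtn_eqF (leq_ltn_trans ax xy)).
by rewrite filter_ins subseq_filter => /andP[].
Qed.

(** The inserted [a] occurs only once, so it cannot be both ends of a pattern. *)
Lemma avoids_ins_notin i a t : (forall x, x \in t -> a <= x) -> a \notin t ->
  avoids t -> avoids (ins i a t).
Proof.
move=> mina a_t At; apply: avoids_ins => // y ay; apply/negP.
rewrite /ins subseq_cat_notin; last by apply: contraNN a_t => /mem_take.
rewrite /= eqxx => /mem_subseq/(_ a); rewrite !inE eqxx orbT => /(_ isT) /mem_drop.
by rewrite (negPf a_t).
Qed.

(** The new copy stands right before the old first [a], so any pattern starting at the new copy
    could start at the old one. *)
Lemma avoids_ins_index a t : (forall x, x \in t -> a <= x) -> a \in t ->
  avoids t -> avoids (ins (index a t) a t).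
Proof.
move=> mina a_t At; apply: avoids_ins => // y ay; apply/negP.
have a_t1 : a \notin take (index a t) t by rewrite in_take_leq ?index_size // ltnn.
rewrite /ins subseq_cat_notin //= eqxx (drop_nth 0) ?index_mem // nth_index //=.
rewrite gtn_eqF // => sub; have := At a y ay.
rewrite -(cat_take_drop (index a t) t) subseq_cat_notin //.
by rewrite (drop_nth 0) ?index_mem // nth_index //= eqxx sub.
Qed.

(** This is the contiguity of the smallest letter: a larger letter [b] right after the first [a]
    would form [a b a] with a later [a]. Hence the second [a] moves into the place of the first. *)
Lemma index_rem_avoids a t : (forall x, x \in t -> a <= x) -> a \in rem a t ->
  avoids t -> index a (rem a t) = index a t.
Proof.
move=> mina a_r At; have a_t := mem_rem a_r.
have a_t1 := notin_take_index_rem a t; have tE := ins_index_rem a_t.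
move: (index a t) (rem a t) a_t1 tE a_r => i r a_r1 tE.
rewrite -(cat_take_drop i r) mem_cat (negPf a_r1) /=.
case rE: (drop i r) => [|b w] //= a_w.
have i_r : i <= size r by rewrite ltnW // -subn_gt0 -size_drop rE.
rewrite index_cat (negPf a_r1) size_take_min (minn_idPl i_r) /=.
case: eqP => [|/eqP ba]; rewrite ?addn0 //.
have ab : a < b.
  rewrite ltn_neqAle eq_sym ba mina // -tE mem_ins.
  by rewrite -(cat_take_drop i r) rE mem_cat mem_head !orbT.
move: a_w; rewrite inE eq_sym (negPf ba) /= => a_w.
have := At a b ab; rewrite -tE /ins subseq_cat_notin // rE /= !eqxx sub1seq.
by rewrite a_w.
Qed.

(** * Counting 010-avoiding words with a prescribed number of small letters *)

(** The last condition counts the letters of [V] that occur in [t], each once; [M] may occur or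
    not. *)
Definition words M V L k t :=
  [/\ size t = L, avoids t, {subset t <= M :: V} & count (mem t) V = k].

Lemma count_mem_cons (a : nat) (t V : seq nat) :
  count (mem t) (a :: V) = (a \in t) + count (mem t) V.
Proof. by []. Qed.

Lemma words_cons_notin M a V L k t : a != M -> a \notin V ->
  words M (a :: V) L k t /\ a \notin t <-> words M V L k t.
Proof.
move=> aM aV; split=> [[[st At sub]]|[st At sub <-]].
  rewrite count_mem_cons => <- a_t; rewrite (negPf a_t); split=> // x xt.
  have /negPf xa := memPn a_t x xt.
  by have := sub x xt; rewrite !inE xa.
have a_t : a \notin t by apply/negP => /sub; rewrite inE (negPf aM) (negPf aV).
split=> //; split; rewrite ?count_mem_cons ?(negPf a_t) // => x /sub.
by rewrite !inE => /orP[]->; rewrite ?orbT.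
Qed.

(** An insertion raises the number of letters used only when [a] was absent, hence the boolean in
    the count. *)
Lemma words_ins M a V L k i t : a \notin V -> avoids t -> avoids (ins i a t) ->
  words M (a :: V) L.+1 ((a \notin t) + k) (ins i a t) <-> words M (a :: V) L k t.
Proof.
move=> aV At Ai.
have insV : count (mem (ins i a t)) V = count (mem t) V.
  by apply: eq_in_count => v vV; rewrite /= mem_ins; case: eqVneq => // va; rewrite -va vV in aV.
rewrite /words size_ins !count_mem_cons insV mem_ins eqxx /=.
split=> -[st _ sub ct]; split=> //.
- by case: st.
- by move=> x xt; apply: sub; rewrite mem_ins xt orbT.
- by move: ct; case: (a \in t) => /=; lia.
- by rewrite st.
- by move=> x; rewrite mem_ins => /orP[/eqP->|/sub]; rewrite // !inE eqxx orbT.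
- by move: ct; case: (a \in t) => /=; lia.
Qed.

(** Induction on [L] along [wordnumSS], deleting the first [a]. If no [a] is left, there were [L.+1]
    possible places and the rest is a word over [V] with [k] letters; otherwise the place is forced
    and the rest still uses [k.+1] letters. [N] stands for the number of ways to choose the [k]
    letters of [V]. *)
Lemma card_words_mem M a V L k N : (forall v, v \in V -> a < v) -> a < M ->
  (forall L, card_is (words M V L k) (N * wordnum L k)) ->
  card_is (fun t => words M (a :: V) L k.+1 t /\ a \in t) (N * wordnum L k.+1).
Proof.
move=> aV aM cV.
have a_V : a \notin V by apply/negP => /aV; rewrite ltnn.
have a_M : a != M by rewrite ltn_eqF.
elim: L => [|L IHL].
  by rewrite wordnum0S muln0; apply: card_is0 => t [[/size0nil->]].
have minV L' k' t : words M (a :: V) L' k' t -> forall x, x \in t -> a <= x.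
  case=> _ _ sub _ x /sub; rewrite !inE => /or3P[/eqP->|/eqP->|/aV]; lia.
rewrite wordnumSS mulnDr mulnCA.
(* Words with exactly one [a], at position [i]; deleting it recovers the rest. *)
have cI i : i \in iota 0 L.+1 -> card_is
   (fun t => exists2 t', words M V L k t' & t = ins i a t') (N * wordnum L k).
  move=> _; apply: card_is_image (cV L) => t t' [_ _ sub _] [_ _ sub' _] /(congr1 (rem a)).
  have a_t : a \notin t by apply/negP => /sub; rewrite inE (negPf a_M) (negPf a_V).
  have a_t' : a \notin t' by apply/negP => /sub'; rewrite inE (negPf a_M) (negPf a_V).
  by rewrite !rem_ins //; [apply: contraNN a_t' | apply: contraNN a_t]; move=> /mem_take.
have c1 := card_is_bigU (iota_uniq 0 L.+1) cI.
(* Words with at least two copies of [a]: a new copy goes in front of the first one. *)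
have c2 : card_is (fun t => exists2 t', words M (a :: V) L k.+1 t' /\ a \in t' &
   t = ins (index a t') a t') (N * wordnum L k.+1).
  apply: card_is_image IHL => t t' [_ a_t] [_ a_t'] /(congr1 (rem a)).
  by rewrite !rem_ins ?in_take_leq ?index_size ?ltnn.
rewrite big_const_seq count_predT size_iota iter_addn_0 (mulnC _ L.+1) in c1.
have onceE i t : i \in iota 0 L.+1 -> words M V L k t ->
    [/\ words M (a :: V) L.+1 k.+1 (ins i a t), a \notin t, a \notin take i t & i <= size t].
  rewrite mem_iota add0n ltnS /= => iL w.
  have [w' a_t] : words M (a :: V) L k t /\ a \notin t by apply/words_cons_notin.
  have [st At _ _] := w; split; rewrite ?st //.
    rewrite -[k.+1]/(true + k) -a_t words_ins //.
    by apply: avoids_ins_notin => //; apply: minV w'.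
  by apply: contraNN a_t => /mem_take.
have twiceE t : words M (a :: V) L k.+1 t -> a \in t ->
    words M (a :: V) L.+1 k.+1 (ins (index a t) a t).
  move=> w a_t; have [_ At _ _] := w.
  rewrite -[k.+1]add0n -[0]/(nat_of_bool (~~ true)) -a_t words_ins //.
  by apply: avoids_ins_index => //; apply: minV w.
apply: eq_card_is (card_isU _ (c1 _) c2).
- move=> t; split.
    case=> [[i iL [t' w ->]]|[t' [w a_t'] ->]].
      by have [] := onceE i t' iL w; rewrite mem_ins eqxx.
    by rewrite mem_ins eqxx; split=> //; apply: twiceE.
  case=> w a_t; have [st At _ _] := w.
  have Ar : avoids (rem a t) by apply: avoids_subseq At; apply: rem_subseq.
  have tE := ins_index_rem a_t; have minT := minV _ _ _ w.
  have wE b : words M (a :: V) L.+1 ((a \notin rem a t) + b) t -> words M (a :: V) L b (rem a t).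
    by have := @words_ins M a V L b (index a t) (rem a t) a_V Ar; rewrite tE => /(_ At)[].
  have iL : index a t \in iota 0 L.+1.
    by rewrite mem_iota add0n -st index_mem.
  have [a_r|a_r] := boolP (a \in rem a t).
    right; exists (rem a t); last by rewrite index_rem_avoids.
    by split=> //; apply: wE; rewrite a_r.
  left; exists (index a t) => //; exists (rem a t) => //.
  by apply/(words_cons_notin _ _ _ a_M a_V); split=> //; apply: wE; rewrite a_r.
(* The two families are disjoint: after deleting the first [a], one has no [a] left and the other
   does. *)
- move=> t [i iL [t' w ->]] [t'' [_ a_t''] /(congr1 (rem a))].
  have [_ a_t' a_tk it'] := onceE i t' iL w.
  rewrite !rem_ins // ?in_take_leq ?index_size ?ltnn // => tE.
  by rewrite tE a_t'' in a_t'.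
(* For words with a single [a], the insertion position is the index of [a]. *)
move=> i j t iL jL [t' w ->] [t'' w' /(congr1 (index a))].
have [_ _ ? ?] := onceE i t' iL w; have [_ _ ? ?] := onceE j t'' jL w'.
by rewrite !index_ins.
Qed.

(** Induction on [V], whose head [a] is its smallest letter because [V] is sorted. Splitting by
    whether [a] occurs gives the two terms of Pascal's rule. *)
Lemma card_words M V L k : sorted ltn V -> (forall v, v \in V -> v < M) ->
  card_is (words M V L k) ('C(size V, k) * wordnum L k).
Proof.
elim: V L k => [|a V IHV] L k.
  move=> _ _; case: k => [|k]; last by rewrite mul0n; apply: card_is0 => t [].
  (* Without smaller letters only the constant word [M] remains. *)
  rewrite wordnum0; apply: eq_card_is (card_is1 (nseq L M)) => t; split=> [->|[st _ sub _]].
    split; rewrite ?size_nseq //; last by move=> x /nseqP[->]; rewrite mem_head.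
    move=> x y xy; apply/negP => /mem_subseq sub.
    have /sub/nseqP[xM _] := mem_head x [:: y; x].
    have /sub/nseqP[yM _] : y \in [:: x; y; x] by rewrite !inE eqxx orbT.
    by rewrite xM yM ltnn in xy.
  by rewrite -st; apply/all_pred1P/allP => x /sub; rewrite mem_seq1.
move=> /= pV ltM; have aV v : v \in V -> a < v.
  by move: pV; rewrite path_sortedE => [/andP[/allP H _] /H|? ? ?]; [|apply: ltn_trans].
have a_M : a < M by apply: ltM; rewrite mem_head.
have a_V : a \notin V by apply/negP => /aV; rewrite ltnn.
have {}IHV L' k' : card_is (words M V L' k') ('C(size V, k') * wordnum L' k').
  by apply: IHV => [|v vV]; [apply: path_sorted pV | rewrite ltM // inE vV orbT].
case: k => [|k].
  (* With no small letter used, [a] is absent and the word is already one over [V]. *)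
  rewrite bin0 -(bin0 (size V)); apply: eq_card_is (IHV L 0) => t.
  rewrite -(words_cons_notin _ _ _ _ a_V) ?ltn_eqF //.
  split=> [[]//|w]; split=> //; case: w => _ _ _; rewrite count_mem_cons.
  by case: (a \in t).
rewrite /= binS mulnDl;
apply: eq_card_is (card_isU _ (IHV L k.+1) (card_words_mem L aV a_M (IHV ^~ k))).
- move=> t; rewrite -(words_cons_notin _ _ _ _ a_V) ?ltn_eqF //.
  by split=> [[[]//|[]//]|w]; case: (boolP (a \in t)) => a_t; [right|left].
by move=> t; rewrite -(words_cons_notin _ _ _ _ a_V) ?ltn_eqF // => -[_ /negP a_t] [_ /a_t].
Qed.

(** * Avoidance across the first maximum *)

(** A value [x] common to [u] and [t] gives the pattern [x m x]. Otherwise the two equal ends of a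
    pattern lie on the same side, and [m] cannot be the low letter, so the pattern is inside [u] or
    inside [t]. *)
Lemma avoids_cat_max u m t : (forall x, x \in u -> x < m) -> (forall x, x \in t -> x <= m) ->
  avoids (u ++ m :: t) <-> [/\ avoids u, avoids t & forall x, x \in u -> x \notin t].
Proof.
move=> um tm; split=> [A|[Au At dis] x y xy].
  split; [|apply: avoids_subseq A|move=> x xu].
  - by apply: avoids_subseq A; apply: prefix_subseq.
  - by rewrite -cat_rcons suffix_subseq.
  have := A x m (um x xu); apply: contraNN => xt.
  by rewrite -cat1s -[[:: m; x]]/([:: m; x]) cat_subseq ?sub1seq //= eqxx sub1seq.
have [xu|xu] := boolP (x \in u); last first.
  rewrite subseq_cat_notin //=; have [xm|xm] := eqVneq x m; last exact: At.
  apply/negP => /mem_subseq/(_ y (mem_head _ _))/tm.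
  by rewrite -xm leqNgt xy.
(* Here the last [x] must lie in [u]; reversing the words turns this into the statement about a
   first letter, [subseq_cat_notin]. *)
have := Au x y xy; rewrite -subseq_rev => Ar.
rewrite -subseq_rev rev_cat subseq_cat_notin //.
by rewrite mem_rev inE negb_or dis // andbT ltn_eqF // um.
Qed.

(** * Inversion sequences as lists of natural numbers *)

Definition inv010 n m d (s : seq nat) :=
  [/\ size s = n, forall i, i < n -> nth 0 s i <= i, avoids s,
      \max_(x <- s) x = m & size (undup s) = d].

Lemma subseq_consP (x : nat) r s :
  subseq (x :: r) s <-> exists i, [/\ i < size s, nth 0 s i = x & subseq r (drop i.+1 s)].
Proof.
elim: s => [|y s IHs]; first by split=> // -[i []].
rewrite /=; case: eqP => [->|xy]; split.
- by move=> rs; exists 0; rewrite drop0.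
- case=> -[|i] [] /=; first by rewrite drop0.
  by move=> _ _ /subseq_trans-> //; apply: drop_subseq.
- by move=> /IHs[i [? ? ?]]; exists i.+1.
- case=> -[|i] [] /=; first by move=> _ /esym.
  by move=> ? ? ?; apply/IHs; exists i.
Qed.

Lemma avoidsP s : avoids s <->
  (forall i j l, i < j -> j < l -> l < size s -> nth 0 s i = nth 0 s l ->
     ~~ (nth 0 s i < nth 0 s j)).
Proof.
split=> [A i j l ij jl ls E|A x y xy].
  have js := ltn_trans jl ls; have si := ltn_trans ij js.
  apply/negP => /A/negP; apply; apply/subseq_consP; exists i; split=> //.
  apply/subseq_consP; exists (j - i.+1); rewrite size_drop nth_drop drop_drop subnKC //.
  split=> //; first by rewrite ltn_sub2r // (leq_ltn_trans ij).
  have -> : (j - i.+1).+1 + i.+1 = j.+1 by lia.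
  by rewrite sub1seq E -(subnKC jl) -nth_drop mem_nth // size_drop ltn_sub2r // (leq_ltn_trans jl).
apply/negP => /subseq_consP[i [si xE /subseq_consP[j []]]].
rewrite size_drop nth_drop drop_drop => sj yE /subseq_consP[l []].
rewrite size_drop nth_drop => sl lE _.
have := A i (i.+1 + j) (j.+1 + i.+1 + l).
rewrite xE yE lE xy => H.
by suff /negP : ~~ true by []; apply: H => //; rewrite -?ltn_subRL //; lia.
Qed.

Lemma nth_map_val n (s : n.-tuple 'I_n) (i : 'I_n) : nth 0 [seq val x | x <- s] i = tnth s i.
Proof. by rewrite (tnth_nth i) (nth_map i) ?size_tuple. Qed.

Lemma is_invseqE n (s : n.-tuple 'I_n) :
  is_invseq s <-> forall i, i < n -> nth 0 [seq val x | x <- s] i <= i.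
Proof.
split=> [/forallP H i iN|H]; first by rewrite (nth_map_val s (Ordinal iN)) H.
by apply/forallP => i; rewrite -nth_map_val H.
Qed.

Lemma avoids010E n (s : n.-tuple 'I_n) : avoids010 s <-> avoids [seq val x | x <- s].
Proof.
have sw : size [seq val x | x <- s] = n by rewrite size_map size_tuple.
rewrite avoidsP; split=> [A i j l ij jl|A].
  rewrite sw => ln; have jn := ltn_trans jl ln; have iN := ltn_trans ij jn.
  have := nth_map_val s (Ordinal iN); have := nth_map_val s (Ordinal jn).
  have := nth_map_val s (Ordinal ln); rewrite /= => -> -> -> E.
  apply: contraNN A => lt_s; apply/existsP; exists (Ordinal iN); apply/existsP.
  exists (Ordinal jn); apply/existsP; exists (Ordinal ln).
  by rewrite /= ij jl lt_s andbT; apply/eqP/val_inj.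
apply/negP => /existsP[i /existsP[j /existsP[l /and4P[ij jl /eqP E]]]].
apply/negP; rewrite -!nth_map_val; apply: A ij jl _ _; first by rewrite sw.
by rewrite !nth_map_val E.
Qed.

Lemma maxvalE n (s : n.-tuple 'I_n) : maxval s = \max_(x <- [seq val x | x <- s]) x.
Proof. by rewrite big_map big_tuple. Qed.

Lemma ndistinctE n (s : n.-tuple 'I_n) : ndistinct s = size (undup [seq val x | x <- s]).
Proof.
rewrite undup_map_inj ?size_map; last exact: val_inj.
rewrite -(card_uniqP (undup_uniq s)); apply: eq_card => x; rewrite mem_undup.
by apply/imsetP/tnthP => [[i _ ->]|[i ->]]; exists i.
Qed.

Lemma map_val_surj n (w : seq nat) : (forall x, x \in w -> x < n) ->
  exists s : seq 'I_n, [seq val x | x <- s] = w.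
Proof.
elim: w => [|x w IHw] H; first by exists [::].
have [|s sw] := IHw; first by move=> y yw; apply: H; rewrite inE yw orbT.
by exists (Ordinal (H x (mem_head _ _)) :: s); rewrite /= sw.
Qed.

Lemma card_inv010 n m d : card_is (inv010 n m d) (bnum n m d).
Proof.
exists [seq [seq val x | x <- tval s] |
  s in [set s : n.-tuple 'I_n |
    [&& is_invseq s, avoids010 s, maxval s == m & ndistinct s == d]]].
split; last by rewrite size_map -cardE.
  rewrite map_inj_uniq ?enum_uniq // => s t /inj_map st; exact/val_inj/st/val_inj.
move=> w; split=> [/mapP[s]|[sw iw Aw mw dw]].
  rewrite mem_enum inE => /and4P[/is_invseqE ? /avoids010E ? /eqP<- /eqP<-] ->.
  by split; rewrite ?size_map ?size_tuple ?maxvalE ?ndistinctE.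
(* The entry at index [i] is at most [i], hence below [n], so the list lifts to ['I_n]. *)
have [|s sE] := @map_val_surj n w.
  by move=> x /(nthP 0)[i]; rewrite sw => iN <-; apply: leq_ltn_trans (iw i iN) iN.
have ss : size s == n by apply/eqP; rewrite -[LHS](size_map val) sE.
apply/mapP; exists (Tuple ss); last by rewrite sE.
rewrite mem_enum inE maxvalE ndistinctE /= sE mw dw !eqxx !andbT.
by apply/andP; split; [apply/is_invseqE|apply/avoids010E]; rewrite /= sE.
Qed.

(** * Decomposition at the first maximum *)

(** The letters below [m] still allowed after [u ++ [:: m]], in increasing order as [card_words]
    expects. *)
Definition missing m (u : seq nat) := [seq v <- iota 0 m | v \notin u].

Lemma mem_missing m u v : (v \in missing m u) = (v \notin u) && (v < m).
Proof. by rewrite mem_filter mem_iota. Qed.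

Lemma size_missing m u : (forall x, x \in u -> x < m) ->
  size (missing m u) + size (undup u) = m.
Proof.
move=> um; rewrite -[RHS](size_iota 0) -(count_predC (mem u)) addnC size_filter.
congr (_ + _); rewrite -size_filter; apply/perm_size/uniq_perm.
- exact: undup_uniq.
- exact/filter_uniq/iota_uniq.
move=> x; rewrite mem_undup mem_filter mem_iota /= add0n.
by case: (boolP (x \in u)) => // /um ->.
Qed.

(** The distinct values are those of [u], then [m], then the missing letters that [t] uses. *)
Lemma size_undup_cat_max u m t : (forall x, x \in u -> x < m) ->
  (forall x, x \in t -> x <= m) -> (forall x, x \in u -> x \notin t) ->
  size (undup (u ++ m :: t)) = size (undup u) + (count (mem t) (missing m u)).+1.
Proof.
move=> um tm dis.
have -> : size (undup u) + (count (mem t) (missing m u)).+1 =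
    size (undup u ++ m :: filter (mem t) (missing m u)).
  by rewrite size_cat /= size_filter.
have m_u : m \notin u by apply/negP => /um; rewrite ltnn.
apply/perm_size/uniq_perm; first exact: undup_uniq.
  rewrite cat_uniq undup_uniq cons_uniq !filter_uniq ?iota_uniq // andbT /=.
  rewrite mem_undup negb_or m_u mem_filter mem_missing ltnn !andbF andbT /=.
  by apply/hasPn => x; rewrite mem_filter mem_missing inE mem_undup => /and3P[].
move=> x; rewrite mem_undup !mem_cat mem_undup !inE mem_filter mem_missing.
case: (boolP (x \in u)) => //= _; case: eqVneq => //= xm.
by case: (boolP (x \in t)) => //= /tm; rewrite leq_eqVlt (negPf xm).
Qed.

Lemma leq_max_seq (s : seq nat) x : x \in s -> x <= \max_(y <- s) y.
Proof. by move=> xs; apply: (@leq_bigmax_seq _ s predT id x). Qed.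

Lemma max_seq_mem (s : seq nat) : \max_(x <- s) x \in 0 :: s.
Proof.
elim: s => [|x s IHs]; first by rewrite big_nil mem_head.
rewrite big_cons /maxn; case: ifP => _; last by rewrite !inE eqxx orbT.
by move: IHs; rewrite !inE => /orP[]->; rewrite ?orbT.
Qed.

(** Positivity of [m] excludes the default value [0] of the empty maximum. *)
Lemma max_seqP (s : seq nat) m : 0 < m ->
  \max_(x <- s) x = m <-> m \in s /\ forall x, x \in s -> x <= m.
Proof.
move=> m0; split=> [sm|[ms sm]]; last first.
  apply/eqP; rewrite eqn_leq leq_max_seq // andbT.
  by apply/bigmax_leqP_seq => x xs _; apply: sm.
split=> [|x xs]; last by rewrite -sm leq_max_seq.
by have := max_seq_mem s; rewrite sm inE eqn0Ngt m0.
Qed.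

(** The cut is at the first [m], so its index fixes the size of the prefix. *)
Lemma cat_cons_inj (T : eqType) (m : T) u u' t t' : m \notin u -> m \notin u' ->
  u ++ m :: t = u' ++ m :: t' -> u = u' /\ t = t'.
Proof.
move=> mu mu' E; have su : size u = size u'.
  have := congr1 (index m) E.
  by rewrite !index_cat (negPf mu) (negPf mu') /= eqxx !addn0.
by move/eqP: E; rewrite eqseq_cat // => /andP[/eqP-> /eqP[]].
Qed.

Lemma inv010_bound n m d u : inv010 n m d u -> forall x, x \in u -> x <= m.
Proof. by case=> _ _ _ <- _ x xu; apply: leq_max_seq. Qed.

(* [u] is the part of the sequence before the first occurrence of its maximum. *)
Lemma inv010_decomp n m d s : 0 < m ->
  inv010 n m d s <->
  exists2 i, i \in index_iota 0 d & exists2 p, p \in index_iota m.+1 n.+1 &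
  exists2 j, j \in index_iota 0 m & exists2 u, inv010 p.-1 j i u &
  exists2 t, words m (missing m u) (n - p) (d - i - 1) t & s = u ++ m :: t.
Proof.
move=> m0; split.
  case=> sn si sA /(max_seqP _ m0)[ms sm] sd.
  have sE : s = take (index m s) s ++ m :: drop (index m s).+1 s.
    by rewrite -[LHS](cat_take_drop (index m s)) (drop_nth 0) ?index_mem ?nth_index.
  have mu : m \notin take (index m s) s by rewrite in_take_leq ?index_size ?ltnn.
  have im : index m s < n by rewrite -sn index_mem.
  (* The inversion condition at the first [m] makes its index at least [m]. *)
  have mi : m <= index m s by rewrite -{1}(nth_index 0 ms) si.
  have su : size (take (index m s) s) = index m s.
    by rewrite size_take_min (minn_idPl _) // sn ltnW.
  have st : size (drop (index m s).+1 s) = n - (index m s).+1 by rewrite size_drop sn.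
  have ui k : k < index m s -> nth 0 (take (index m s) s) k <= k.
    by move=> ks; rewrite nth_take // si // (ltn_trans ks).
  move: (index m s) (take _ s) (drop _ s) sE mu im mi su st ui => q u t sE mu im mi su st ui.
  have um x : x \in u -> x < m.
    move=> xu; rewrite ltn_neqAle sm ?sE ?mem_cat ?xu // andbT.
    by apply: contraNneq mu => <-.
  have tm x : x \in t -> x <= m by move=> xt; rewrite sm // sE mem_cat inE xt !orbT.
  rewrite sE in sA; have /(avoids_cat_max um tm)[uA tA dis] := sA.
  have := size_undup_cat_max um tm dis; rewrite -sE sd => dE.
  exists (size (undup u)); first by rewrite mem_index_iota dE addnS ltnS leq_addr.
  (* [p] is the position of the first maximum counted from 1, so [u] has length [p.-1]. *)
  exists q.+1; first by rewrite mem_index_iota; lia.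
  exists (\max_(x <- u) x).
    rewrite mem_index_iota /= -(prednK m0) ltnS; apply/bigmax_leqP_seq => x /um xm _.
    by lia.
  exists u; first by split.
  exists t => //; split=> //; last by rewrite dE addKn subn1.
  move=> x xt; rewrite inE mem_missing; case: eqVneq => //= xm.
  rewrite ltn_neqAle xm tm // !andbT; apply/negP => xu.
  by have := dis x xu; rewrite xt.
case=> i; rewrite mem_index_iota => /andP[_ id] [p]; rewrite mem_index_iota => /andP[mp pn].
case=> j; rewrite mem_index_iota => /andP[_ jm] [u uI] [t [st tA sub ct] ->].
have um x : x \in u -> x < m by move/(inv010_bound uI) => /leq_ltn_trans->.
have tm x : x \in t -> x <= m.
  by move/sub; rewrite inE mem_missing => /orP[/eqP->|/andP[_ /ltnW]].
have dis x : x \in u -> x \notin t.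
  move=> xu; apply/negP => /sub; rewrite inE mem_missing xu ltn_eqF ?um //.
have [su ui uA _ ud] := uI.
split.
- by rewrite size_cat /= st su; lia.
- move=> k kn; rewrite nth_cat su; case: ltnP => [/ui//|pk].
  (* From index [p.-1] on, the index is at least [m] and the letters are at most [m], so the
     inversion condition is automatic. *)
  suff : nth 0 (m :: t) (k - p.-1) <= m by move=> /leq_trans->//; lia.
  have : nth 0 (m :: t) (k - p.-1) \in m :: t by rewrite mem_nth //= st; lia.
  by rewrite inE => /orP[/eqP->|/tm].
- exact/avoids_cat_max.
- apply/max_seqP => //; split=> [|x]; first by rewrite mem_cat mem_head orbT.
  by rewrite mem_cat inE => /or3P[/um/ltnW|/eqP->|/tm].
- by rewrite size_undup_cat_max // ct ud; lia.
Qed.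

(** * The recurrence, first with truncated subtraction and then over the integers *)

(** The sequence determines [i], [p], [j], [u] and [t], so the nested unions of the decomposition
    are disjoint; the number of tails [t] depends on [u] only through its length and its number of
    values. *)
Lemma bnum_rec n m d : 0 < m ->
  bnum n m d = \sum_(0 <= i < d) \sum_(m.+1 <= p < n.+1) \sum_(0 <= j < m)
    bnum p.-1 j i * ('C(m - i, d - i - 1) * wordnum (n - p) (d - i - 1)).
Proof.
move=> m0; apply: card_is_inj (card_inv010 n m d) _.
apply: eq_card_is (fun s => iff_sym (inv010_decomp n d s m0)) _.
have lt_u p j i u : j \in index_iota 0 m -> inv010 p j i u -> forall x, x \in u -> x < m.
  by rewrite mem_index_iota => /= jm /inv010_bound ub x /ub /leq_ltn_trans->.
have notin_u p j i u : j \in index_iota 0 m -> inv010 p j i u -> m \notin u.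
  by move=> jm uI; apply/negP => /(lt_u _ _ _ _ jm uI); rewrite ltnn.
have eq_u p j i u p' j' i' u' t t' : j \in index_iota 0 m -> j' \in index_iota 0 m ->
    inv010 p j i u -> inv010 p' j' i' u' -> u ++ m :: t = u' ++ m :: t' ->
    [/\ p = p', j = j', i = i' & u = u'].
  move=> jm jm' uI uI' /cat_cons_inj[]; [exact: notin_u jm uI|exact: notin_u jm' uI'|].
  by move=> E; case: uI uI' => <- _ _ <- <-; rewrite E => -[<- _ _ <- <-].
apply: card_is_bigU (iota_uniq _ _) _ _ => [i id|i i' s _ _].
  apply: card_is_bigU (iota_uniq _ _) _ _ => [p pm|p p' s].
    apply: card_is_bigU (iota_uniq _ _) _ _ => [j jm|j j' s jm jm'].
      apply: card_is_prod (card_inv010 _ _ _) _ _ => [u uI|u u' s uI uI'].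
        have um := lt_u _ _ _ _ jm uI.
        apply: card_is_image => [t t' _ _ /eqP|]; first by rewrite eqseq_cat // eqxx => /eqP[].
        have [_ _ _ _ ud] := uI.
        (* [u] has [i] distinct values, all below [m], which leaves [m - i] letters. *)
        have -> : m - i = size (missing m u) by have := size_missing um; lia.
        apply: card_words => [|v]; last by rewrite mem_missing => /andP[].
        by apply: sorted_filter; [apply: ltn_trans|apply: iota_ltn_sorted].
      by move=> [t _ ->] [t' _ /(eq_u _ _ _ _ _ _ _ _ _ _ jm jm uI uI')[]].
    by move=> [u uI [t _ ->]] [u' uI' [t' _ /(eq_u _ _ _ _ _ _ _ _ _ _ jm jm' uI uI')[]]].
  (* The size of [u] gives [p.-1], and this determines [p] because [p] is positive. *)
  rewrite !mem_index_iota => /andP[mp _] /andP[mp' _].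
  move=> [j jm [u uI [t _ ->]]] [j' jm' [u' uI' [t' _]]].
  move=> /(eq_u _ _ _ _ _ _ _ _ _ _ jm jm' uI uI')[].
  by lia.
by move=> [p _ [j jm [u uI [t _ ->]]]] [p' _ [j' jm' [u' uI' [t' _
  /(eq_u _ _ _ _ _ _ _ _ _ _ jm jm' uI uI')[]]]]].
Qed.

(** Values at most [m] leave room for at most [m.+1] distinct ones. *)
Lemma bnum_eq0 n m d : m.+1 < d -> bnum n m d = 0.
Proof.
move=> md; apply: card_is_inj (card_inv010 n m d) _; apply: card_is0 => u uI.
have [_ _ _ _ ud] := uI.
have := @size_missing m.+1 u (fun x xu => inv010_bound uI xu).
by rewrite ud; lia.
Qed.

Theorem mainTheorem2 (n m d : nat) (hn : (1 <= n)%N) (hm : (1 <= m)%N) :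
  bnum n m d =
  (\sum_(0 <= i < d)
     binz (m%:Z - i%:Z) (d%:Z - i%:Z - 1) *
     \sum_(m.+1 <= p < n.+1)
        stirz (n - p + 1) (n%:Z - p%:Z - d%:Z + i%:Z + 2) *
        \sum_(0 <= j < m) bnum p.-1 j i)%N.
Proof.
rewrite bnum_rec //; apply: eq_big_nat => i /andP[_ id].
rewrite big_distrr; apply: eq_big_nat => p /andP[mp pn].
(* For [i] above [m] the truncated [m - i] differs from the integer one, but both sides vanish: a
   maximum [j] below [m] allows at most [m] distinct values. *)
rewrite -big_distrl /=; have [im|mi] := leqP i m; last first.
  rewrite big_nat big1 ?mul0n ?muln0 // => j /andP[_ jm].
  by apply: bnum_eq0; lia.
rewrite (_ : (m%:Z - i%:Z)%R = Posz (m - i)); last by lia.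
rewrite (_ : (d%:Z - i%:Z - 1)%R = Posz (d - i - 1)); last by lia.
rewrite mulnC -mulnA /=; congr (_ * (_ * _)); rewrite /wordnum addn1.
(* The lower Stirling index is [(n - p).+1 - (d - i - 1)]. If it is negative, [stirz] is [0], while
   truncation gives index [0] on a nonempty set, again [0]. *)
have [dL|dL] := leqP (d - i - 1) (n - p).+1.
  rewrite (_ : (n%:Z - p%:Z - d%:Z + i%:Z + 2)%R = Posz ((n - p).+1 - (d - i - 1))) //.
  by lia.
case E: (n%:Z - p%:Z - d%:Z + i%:Z + 2)%R => [k|k]; first by lia.
by rewrite (_ : _.+1 - _ = 0) ?stirling1S0 //; lia.
Qed.
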